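(* Let $T=AB$ with $A=L_1\cdots L_p$, $B=U_q\cdots U_1$ be a positive bidiagonal factorization. Set $a_0=1$ and $a_j=M-j+1$ for $j\in\{1,\dots,q\}$. Moving successively the rightmost upper factor to the left carries $T_{(a_{j-1})}$ into $T_{(a_j)}$ (the factor moved at step $j$ is $U_j$). In particular $T_{(a_0)}=T$ and $T_{(a_q)}=T_{(p+1)}=BA$. Fix a weakly normal biorthogonal system $(\boldsymbol B^{(a_0)},\boldsymbol A^{(a_0)},\mathrm d\Psi)$ at $T_{(a_0)}=T$, with nonsingular lower triangular initial-condition matrices, and assume that its right array attains the prescribed maximal step-line degrees. For each $j\in\{1,\dots,q\}$, choose a nonsingular lower triangular right initial-condition matrix $\xi^{(a_j)}$ for which the corresponding right polynomial array $\boldsymbol B^{(a_j)}$ of $T_{(a_j)}$ has the prescribed maximal step-line degrees. Let $S_j(x)$ be the matrix polynomial with $U_j\boldsymbol B^{(a_{j-1})}(x)=\boldsymbol B^{(a_j)}(x)S_j(x)$, and transport the left arrays and moment functionals successively by $\boldsymbol A^{(a_j)}=\boldsymbol A^{(a_{j-1})}U_j^{-1}$, $\mathrm d\Psi^{(a_j)}=S_j\,\mathrm d\Psi^{(a_{j-1})}$, $\mathrm d\Psi^{(a_0)}=\mathrm d\Psi$. Then: (i) There is a nonsingular constant lower triangular matrix $H$ such that $S_q(x)\cdots S_1(x)=xH$. (ii) The composition of the $q$ Christoffel transformations gives the representative $xH\,\mathrm d\Psi$ at $T_{(a_q)}=BA$. Replacing the endpoint right initial condition by $\widehat\xi^{(a_q)}=\xi^{(a_q)}H$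 applies the constant left gauge $H^{-1}$ to the functional, and the endpoint representative becomes $x\,\mathrm d\Psi$. (iii) The circuit obtained by moving successively the lower factors $L_1,\dots,L_p$ has the transposed form: starting from a weakly normal system at $T_{(1)}=T$ whose left array attains its maximal step-line degrees, one chooses a nonsingular lower triangular left initial-condition matrix giving a left-maximal array $\boldsymbol A^{(a+1)}$ at each $T_{(a+1)}$, $1\le a\le p$, and transports the right arrays by $\boldsymbol B^{(a+1)}=L_a^{-1}\boldsymbol B^{(a)}$ and the functionals by $\mathrm d\Psi^{(a+1)}=\mathrm d\Psi^{(a)}R_a$, where $\boldsymbol A^{(a)}(x)L_a=R_a(x)\boldsymbol A^{(a+1)}(x)$. The connection matrices act on the right and their product is $R_1(x)\cdots R_p(x)=xK$, where $K$ is a nonsingular constant upper triangular matrix.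
   Context: Let $p,q\ge1$, $M=p+q$. All semi-infinite matrices are indexed by $\mathbb N_0$. A lower bidiagonal $L$ is normalized if $L_{n,n}=1$, an upper bidiagonal $U$ is normalized if $U_{n,n+1}=1$; positive means that the remaining entries ($L_{n+1,n}$, resp. $U_{n,n}$) are all $>0$. In a positive bidiagonal factorization all factors $L_a$, $U_b$ are normalized positive. $F_a=L_a$ ($1\le a\le p$), $F_{p+b}=U_{q-b+1}$ ($1\le b\le q$), $T_{(a)}=F_a\cdots F_MF_1\cdots F_{a-1}$. $\mathsf E_{[r]}=[\,I_r\ 0\ 0\cdots]$. Step-line spaces: at position $n=qm+j$ ($0\le j<q$) the right polynomial space consists of row vectors of $q$ polynomials whose $s$-th component has degree at most $m$ if $s\le j$ and at most $m-1$ if $s>j$ (negative bound means $0$). At position $n=pm+i$ ($0\le i<p$) the left polynomial space consists of column vectors of $p$ polynomials whose $s$-th component has degree at most $m$ if $s\le i$ and at most $m-1$ if $s>i$. An array attains its prescribed maximal degrees if every component with nonnegative bound has degree equal to its bound. For a $q\times p$ matrix of measures (or moment functional) $\mathrm d\Psi$, the scalar step-line moment matrix is $\mathscr M_{qu+j,pv+i}=\int x^{u+v}\mathrm d\Psi_{j,i}$; weakly normal means that all leading principal minors of $\mathscr M$ are nonzero. A weakly normal biorthogonal system $(\boldsymbol B,\boldsymbol A,\mathrm d\Psi)$ at a banded matrix $\mathcal T$ with initial-condition matrices $\xi,\nu$: $\mathrm d\Psi$ is weakly normal; $\boldsymbol B$ (semi-infinite by $q$) and $\boldsymbol A$ ($p$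 by semi-infinite) lie in the step-line spaces; $\mathcal T\boldsymbol B=x\boldsymbol B$, $\boldsymbol A\mathcal T=x\boldsymbol A$, $\mathsf E_{[q]}\boldsymbol B=\xi$, $\boldsymbol A\mathsf E_{[p]}^{\mathsf T}=\nu^{\mathsf T}$, $\int\boldsymbol B\,\mathrm d\Psi\,\boldsymbol A=I$. Given nonsingular $\xi,\nu$, the recurrence equations determine the corresponding polynomial arrays uniquely, and the functional attached to $(\mathcal T,\xi,\nu)$ has moments $\xi^{-1}\mathsf E_{[q]}\mathcal T^n\mathsf E_{[p]}^{\mathsf T}\nu^{-\mathsf T}$; a representative is a matrix of measures (or functional) with these moments. In the situation of the statement the connection polynomials $S_j$ and $R_a$ exist, are unique, and have degree one with determinant a nonzero multiple of $x$. *)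

(* Defs.v *)
From HB Require Import structures.
From mathcomp Require Import all_boot all_order all_algebra.
From mathcomp Require Import all_classical reals.
Set Implicit Arguments. Unset Strict Implicit. Unset Printing Implicit Defensive.
Import Order.TTheory GRing.Theory Num.Theory.
Local Open Scope ring_scope.

Section Matrices.
Variable R : realType.

Definition smx := nat -> nat -> R.

Definition sid : smx := fun n k => (n == k)%:R.

(* [\sum_(k \in A)] is the sum over the finite support of the summand; every
   product used below (banded by banded, banded by array, triangular inverse
   by array) has finitely many nonzero terms. *)
Definition smul (X Y : smx) : smx :=
  fun n k => \sum_(i \in [set: nat]) X n i * Y i k.

Definition sexp (X : smx) (n : nat) : smx := iter n (smul X) sid.

Definition leading (N : nat) (X : smx) : 'M[R]_N := \matrix_(i < N, j < N) X i j.

Definition corner (q p : nat) (X : smx) : 'M[R]_(q, p) :=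
  \matrix_(i < q, j < p) X i j.

(* Inverse of a triangular semi-infinite matrix with nonzero diagonal: its
   leading blocks are the inverses of the leading blocks. *)
Definition sinv (X : smx) : smx :=
  fun n k => invmx (leading (maxn n k).+1 X) (inord n) (inord k).

Definition pos_lower (X : smx) : Prop :=
  [/\ forall n, X n n = 1, forall n, 0 < X n.+1 n
    & forall n k, n != k -> n != k.+1 -> X n k = 0].

Definition pos_upper (X : smx) : Prop :=
  [/\ forall n, X n n.+1 = 1, forall n, 0 < X n n
    & forall n k, n != k -> n.+1 != k -> X n k = 0].

Section Factors.
Variables (p q : nat) (L U : nat -> smx).

Definition Lprod : smx := \big[smul/sid]_(1 <= a < p.+1) L a.

(* U_q ... U_1 *)
Definition Uprod : smx := \big[smul/sid]_(0 <= b < q) U (q - b)%N.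

(* F_a = L_a for a <= p and F_(p+b) = U_(q-b+1). *)
Definition cfactor (a : nat) : smx :=
  if (a <= p)%N then L a else U (q - (a - p) + 1)%N.

Definition Fprod (a b : nat) : smx := \big[smul/sid]_(a <= i < b) cfactor i.

Definition Tcyc (a : nat) : smx := smul (Fprod a (p + q).+1) (Fprod 1 a).

(* a_0 = 1 and a_j = (p + q) - j + 1 for j >= 1. *)
Definition cidx (j : nat) : nat := if j is 0 then 1 else ((p + q) - j + 1)%N.

End Factors.

Section Arrays.
Variables p q : nat.

Definition rarray := nat -> 'rV[{poly R}]_q.
Definition larray := nat -> 'cV[{poly R}]_p.

Definition mulTB (X : smx) (B : rarray) : rarray :=
  fun n => \sum_(k \in [set: nat]) (X n k)%:P *: B k.

Definition mulAT (A : larray) (X : smx) : larray :=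
  fun n => \sum_(k \in [set: nat]) (X k n)%:P *: A k.

(* For n = d m + j, one more than the maximal degree of component s at step-line
   position n; the value 0 encodes the bound -1. *)
Definition slsize (d n s : nat) : nat := (n %/ d + (s <= n %% d))%N.

Definition right_stepline (B : rarray) : Prop :=
  forall n (s : 'I_q), (size (B n 0%R s) <= slsize q n s)%N.

Definition left_stepline (A : larray) : Prop :=
  forall n (s : 'I_p), (size (A n s 0%R) <= slsize p n s)%N.

Definition right_maximal (B : rarray) : Prop :=
  right_stepline B /\
  forall n (s : 'I_q), (0 < slsize q n s)%N -> size (B n 0%R s) = slsize q n s.

Definition left_maximal (A : larray) : Prop :=
  left_stepline A /\
  forall n (s : 'I_p), (0 < slsize p n s)%N -> size (A n s 0%R) = slsize p n s.

Definition right_array (T : smx) (xi : 'M[R]_q) (B : rarray) : Prop :=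
  (forall n, mulTB T B n = 'X *: B n) /\
  \matrix_(i < q, s < q) B i 0 s = map_mx polyC xi.

Definition left_array (T : smx) (nu : 'M[R]_p) (A : larray) : Prop :=
  (forall n, mulAT A T n = 'X *: A n) /\
  \matrix_(s < p, i < p) A i s 0 = map_mx polyC nu^T.

(* A moment functional; a measure with finite moments acts by integration. *)
Definition mfunctional := {scalar {poly R}}.

Definition functional_mx := 'M[mfunctional]_(q, p).

(* \int r dPsi c. *)
Definition pairing (Psi : functional_mx) (r : 'rV[{poly R}]_q)
    (c : 'cV[{poly R}]_p) : R :=
  \sum_(j < q) \sum_(i < p) Psi j i (r 0 j * c i 0).

Definition moment (Psi : functional_mx) (n : nat) : 'M[R]_(q, p) :=
  \matrix_(j < q, i < p) Psi j i 'X^n.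

Definition lmulf_entry (S : 'M[{poly R}]_q) (Psi : functional_mx)
    (j : 'I_q) (i : 'I_p) (f : {poly R}) : R :=
  \sum_(k < q) Psi k i (S j k * f).

Lemma lmulf_entry_linear S Psi j i : scalar (lmulf_entry S Psi j i).
Proof.
move=> a f g; rewrite /lmulf_entry mulr_sumr -big_split /=.
by apply: eq_bigr => k _; rewrite mulrDr -scalerAr linearP.
Qed.

HB.instance Definition _ S Psi j i :=
  GRing.isLinear.Build R {poly R} R *%R (lmulf_entry S Psi j i)
    (lmulf_entry_linear S Psi j i).

Definition rmulf_entry (Psi : functional_mx) (S : 'M[{poly R}]_p)
    (j : 'I_q) (i : 'I_p) (f : {poly R}) : R :=
  \sum_(k < p) Psi j k (f * S k i).

Lemma rmulf_entry_linear Psi S j i : scalar (rmulf_entry Psi S j i).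
Proof.
move=> a f g; rewrite /rmulf_entry mulr_sumr -big_split /=.
by apply: eq_bigr => k _; rewrite mulrDl -scalerAl linearP.
Qed.

HB.instance Definition _ Psi S j i :=
  GRing.isLinear.Build R {poly R} R *%R (rmulf_entry Psi S j i)
    (rmulf_entry_linear Psi S j i).

(* S dPsi and dPsi S. *)
Definition lmulf (S : 'M[{poly R}]_q) (Psi : functional_mx) : functional_mx :=
  \matrix_(j < q, i < p) (lmulf_entry S Psi j i : mfunctional).

Definition rmulf (Psi : functional_mx) (S : 'M[{poly R}]_p) : functional_mx :=
  \matrix_(j < q, i < p) (rmulf_entry Psi S j i : mfunctional).

(* Moments xi^-1 E_[q] T^n E_[p]^T nu^-T of the functional attached to (T, xi, nu). *)
Definition attached_moment (T : smx) (xi : 'M[R]_q) (nu : 'M[R]_p) (n : nat) :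
    'M[R]_(q, p) :=
  invmx xi *m corner q p (sexp T n) *m (invmx nu)^T.

Definition represents (T : smx) (xi : 'M[R]_q) (nu : 'M[R]_p)
    (Psi : functional_mx) : Prop :=
  forall n, moment Psi n = attached_moment T xi nu n.

Definition nonsing_lower (m : nat) (X : 'M[R]_m) : Prop :=
  is_trig_mx X /\ X \in unitmx.

Definition nonsing_upper (m : nat) (X : 'M[R]_m) : Prop :=
  is_trig_mx X^T /\ X \in unitmx.

Variables (hp : (0 < p)%N) (hq : (0 < q)%N).

Definition stepline_moments (Psi : functional_mx) : smx := fun n k =>
  Psi (Ordinal (ltn_pmod n hq)) (Ordinal (ltn_pmod k hp)) 'X^(n %/ q + k %/ p)%N.

Definition weakly_normal (Psi : functional_mx) : Prop :=
  forall N, \det (leading N (stepline_moments Psi)) != 0.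

Record wn_system (T : smx) (xi : 'M[R]_q) (nu : 'M[R]_p)
    (B : rarray) (A : larray) (Psi : functional_mx) : Prop := WnSystem {
  wn_normal : weakly_normal Psi;
  wn_right_stepline : right_stepline B;
  wn_left_stepline : left_stepline A;
  wn_right : right_array T xi B;
  wn_left : left_array T nu A;
  wn_biorthogonal : forall n k, pairing Psi (B n) (A k) = (n == k)%:R
}.

End Arrays.
End Matrices.

(* Main.v *)
Require Import Defs.
From HB Require Import structures.
From mathcomp Require Import all_boot all_order all_algebra.
From mathcomp Require Import all_classical reals.
From mathcomp Require Import zify.
Set Implicit Arguments. Unset Strict Implicit. Unset Printing Implicit Defensive.
Import Order.TTheory GRing.Theory Num.Theory.
Local Open Scope ring_scope.

(** Write T = X Y with X = L_1 ... L_p lower and Y = U_q ... U_1 upper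
    triangular.  In the upper circuit the q connection relations compose to
    Y B = B' S, where B' is the right array at Y X and S = S_q ... S_1.
    Applying X gives X B' S = T B = x B.  Since X is lower triangular, the first
    q rows of this identity see only the leading q by q block of X and the two
    initial conditions: X_[q] xi' S = x xi.  Hence S = x H with
    H = (X_[q] xi')^-1 xi, which is lower triangular and nonsingular.

    The endpoint is again a biorthogonal system, because an invertible
    triangular matrix can be cancelled.  The transported left array satisfies
    A' Y = A; from A X Y = x A = (x A') Y one gets A X = x A', that is
    A' (Y X) = x A'.  Similarly the matrix Q of pairings of B' and A' for S dPsi
    pairs Y B with A' for dPsi, so Q Y = Y and Q = I.  These steps are carried
    out in [circuit].

    Weak normality comes with biorthogonality.  Expanding step-line arrays in
    monomials gives lower triangular coefficient matrices b and a, and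
    biorthogonality reads b M a^T = I for the step-line moment matrix M.
    Triangularity lets every leading block of this identity be taken factor by
    factor, so all leading blocks of b, M and a are invertible
    ([leading_gram]).  As the right initial condition is the leading q by q
    block of b, it is lower triangular and nonsingular ([initial_nonsing]).

    The lower circuit is the transpose of the upper one: (T, B, A, dPsi)
    becomes (T^T, A^T, B^T, dPsi^T), which exchanges p and q and turns the moves
    of L_1, ..., L_p into moves of the upper factors L_p^T ... L_1^T
    ([right_circuit], [left_circuit]).

    The finite-support sums behind the products are handled by letting
    row-finite matrices act on sequences in a module ([act]); both kinds of
    arrays, and the columns of a matrix, are such sequences. *)

(** * Row-finite matrices and their action on sequences *)

Lemma fsum_nat (V : nmodType) (f : nat -> V) (N : nat) :
  (forall k, (N <= k)%N -> f k = 0) ->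
  \sum_(k \in [set: nat]) f k = \sum_(k < N) f k.
Proof.
move=> f0; rewrite fsbig_ord; apply/esym/fsbig_widen => // k [_ /= /negP].
by rewrite -leqNgt => /f0.
Qed.

Section Matrices.
Variable R : realType.
Implicit Types X Y Z : smx R.

Definition transp X : smx R := fun n k => X k n.

(** One uniform band rather than mere row-finiteness: the bound of a product is
    then the sum of the bounds, and the range of summation is explicit. *)
Definition row_banded X := exists w, forall n k, (n + w < k)%N -> X n k = 0.

Definition lower_tri X := forall n k, (n < k)%N -> X n k = 0.

Definition lower_inv X := lower_tri X /\ forall n, X n n != 0.

Lemma lower_tri_row_banded X : lower_tri X -> row_banded X.
Proof. by move=> X0; exists 0%N => n k; rewrite addn0 => /X0. Qed.

Lemma lower_tri_sid : lower_tri (sid R).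
Proof. by move=> n k; rewrite /sid; case: ltngtP. Qed.

Lemma smul_row X Y n k w : (forall i, (n + w < i)%N -> X n i = 0) ->
  smul X Y n k = \sum_(i < (n + w).+1) X n i * Y i k.
Proof. by move=> X0; apply: fsum_nat => i /X0 ->; rewrite mul0r. Qed.

Lemma transp_smul X Y : transp (smul X Y) = smul (transp Y) (transp X).
Proof.
apply/funext => n; apply/funext => k; rewrite /transp /smul.
by apply: eq_fsbigr => i _; rewrite mulrC.
Qed.

Lemma transp_sid : transp (sid R) = sid R.
Proof. by apply/funext => n; apply/funext => k; rewrite /transp /sid eq_sym. Qed.

Lemma row_banded_smul X Y :
  row_banded X -> row_banded Y -> row_banded (smul X Y).
Proof.
move=> [u X0] [w Y0]; exists (u + w)%N => n k nk.
rewrite (smul_row _ _ (X0 n)) big1 // => i _; rewrite Y0 ?mulr0 //.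
by have := ltn_ord i; lia.
Qed.

Lemma lower_inv_smul X Y : lower_inv X -> lower_inv Y -> lower_inv (smul X Y).
Proof.
have smulE A B n k : lower_tri A ->
    smul A B n k = \sum_(i < n.+1) A n i * B i k.
  by move=> A0; rewrite -[n in n.+1]addn0; apply: smul_row => i; rewrite addn0 => /A0.
move=> [X0 Xd] [Y0 Yd]; split=> [n k nk|n].
  rewrite smulE // big1 // => i _; rewrite Y0 ?mulr0 //.
  by have := ltn_ord i; lia.
rewrite smulE // big_ord_recr big1 /= ?add0r ?mulf_neq0 // => i _.
by rewrite Y0 ?mulr0.
Qed.

(** Right arrays take V to be row vectors of polynomials, left arrays take
    column vectors and the transposed matrix; associativity, cancellation and
    inversion are then proved once for both. *)
Definition act (V : lmodType {poly R}) X (v : nat -> V) : nat -> V :=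
  fun n => \sum_(k \in [set: nat]) (X n k)%:P *: v k.

Section Act.
Variable V : lmodType {poly R}.
Implicit Types v w : nat -> V.

Lemma act_row X v n d : (forall i, (n + d < i)%N -> X n i = 0) ->
  act X v n = \sum_(i < (n + d).+1) (X n i)%:P *: v i.
Proof. by move=> X0; apply: fsum_nat => i /X0 ->; rewrite scale0r. Qed.

Lemma act_lower X v n : lower_tri X ->
  act X v n = \sum_(i < n.+1) (X n i)%:P *: v i.
Proof.
by move=> X0; rewrite -[n in n.+1]addn0; apply: act_row => i; rewrite addn0 => /X0.
Qed.

Lemma act_sid v : act (sid R) v = v.
Proof.
apply/funext => n; rewrite act_lower; last exact: lower_tri_sid.
rewrite big_ord_recr /= big1 => [|i _]; rewrite /sid ?eqxx ?add0r ?scale1r //.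
by rewrite gtn_eqF ?scale0r.
Qed.

Lemma act_smul X Y v : row_banded X -> row_banded Y ->
  act (smul X Y) v = act X (act Y v).
Proof.
move=> [u X0] [d Y0]; apply/funext => n.
(* One finite range that contains the support of both iterated sums. *)
pose N := (n + (u + d)).+1.
have -> : act (smul X Y) v n = \sum_(k < N) (smul X Y n k)%:P *: v k.
  apply: act_row => k nk; rewrite (smul_row _ _ (X0 n)) big1 // => i _.
  by rewrite Y0 ?mulr0 //; have := ltn_ord i; lia.
have -> : act X (act Y v) n =
    \sum_(i < (n + u).+1) \sum_(k < N) ((X n i)%:P * (Y i k)%:P) *: v k.
  rewrite (act_row _ (X0 n)); apply: eq_bigr => i _.
  have -> : act Y v i = \sum_(k < N) (Y i k)%:P *: v k.
    apply: fsum_nat => k Nk; rewrite Y0 ?scale0r //.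
    by have := ltn_ord i; move: Nk; rewrite /N; lia.
  by rewrite scaler_sumr; under eq_bigr do rewrite scalerA.
rewrite exchange_big; apply: eq_bigr => k _.
rewrite (smul_row _ _ (X0 n)) raddf_sum scaler_suml /=.
by under eq_bigr do rewrite rmorphM.
Qed.

Lemma act_scale X (c : {poly R}) v : row_banded X ->
  act X (fun k => c *: v k) = (fun n => c *: act X v n).
Proof.
move=> [d X0]; apply/funext => n; rewrite !(act_row _ (X0 n)) scaler_sumr.
by apply: eq_bigr => k _; rewrite !scalerA mulrC.
Qed.

(** Entry n of X v is a nonzero multiple of v_n plus earlier entries, so v is
    recovered by strong induction. *)
Lemma act_inj X v w : lower_inv X -> act X v =1 act X w -> v =1 w.
Proof.
move=> [X0 Xd] vw; elim/ltn_ind => n IH.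
have := vw n; rewrite !act_lower // !big_ord_recr /=.
rewrite (eq_bigr (fun i : 'I_n => (X n i)%:P *: w i)); last by move=> i _; rewrite IH.
move=> /addrI /(congr1 (GRing.scale (X n n)^-1%:P)).
by rewrite !scalerA -polyCM mulVf // !scale1r.
Qed.

End Act.

Lemma act_linear (V W : lmodType {poly R}) (f : {linear V -> W}) X (v : nat -> V) n :
  row_banded X -> f (act X v n) = act X (f \o v) n.
Proof.
move=> [d X0]; rewrite !(act_row _ (X0 n)) linear_sum /=.
by apply: eq_bigr => i _; rewrite linearZZ.
Qed.

(** A column, as a sequence of constant polynomials in the regular module: laws
    of the action thereby specialise to laws of matrix products. *)
Definition pcol Y k : nat -> {poly R}^o := fun i => (Y i k)%:P.

Lemma act_pcol X Y k : row_banded X -> act X (pcol Y k) = pcol (smul X Y) k.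
Proof.
move=> [w X0]; apply/funext => n; rewrite (act_row _ (X0 n)) /pcol.
rewrite (smul_row _ _ (X0 n)) raddf_sum.
by apply: eq_bigr => i _; rewrite /= rmorphM.
Qed.

Lemma pcol_inj X Y : (forall k, pcol X k = pcol Y k) -> X = Y.
Proof.
move=> XY; apply/funext => n; apply/funext => k.
by have /(congr1 (fun f => f n)) /polyC_inj := XY k.
Qed.

(** The last factor is arbitrary, so that products with moment and Gram
    matrices, which are full, are covered. *)
Lemma smulA X Y Z : row_banded X -> row_banded Y ->
  smul (smul X Y) Z = smul X (smul Y Z).
Proof.
move=> bX bY; apply: pcol_inj => k.
by rewrite -!act_pcol ?act_smul //; exact: row_banded_smul.
Qed.

Lemma smul1m X : smul (sid R) X = X.
Proof.
apply: pcol_inj => k; rewrite -act_pcol ?act_sid //.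
exact/lower_tri_row_banded/lower_tri_sid.
Qed.

Lemma smulm1 X : smul X (sid R) = X.
Proof.
have trK Y Z : transp Y = transp Z -> Y = Z by move=> /(congr1 transp).
by apply: trK; rewrite transp_smul transp_sid smul1m.
Qed.

End Matrices.

(** * Triangular inverses, functionals and Gram matrices *)

Section FiniteTriangular.
Variables (F : fieldType) (n : nat).
Implicit Types A B : 'M[F]_n.

Lemma trig_unitmx_diag A : is_trig_mx A -> (A \in unitmx) = [forall i, A i i != 0].
Proof.
move=> tA; rewrite unitmxE det_trig // unitfE.
apply/prodf_neq0/forallP => [Ad i|Ad i _]; last exact: Ad.
exact: Ad.
Qed.

Lemma trig_mulmx A B : is_trig_mx A -> is_trig_mx B -> is_trig_mx (A *m B).
Proof.
move=> /is_trig_mxP A0 /is_trig_mxP B0; apply/is_trig_mxP => i j ij.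
rewrite mxE big1 // => k _.
have [ik|ki] := ltnP i k; first by rewrite A0 ?mul0r.
by rewrite B0 ?mulr0 //; exact: leq_ltn_trans ij.
Qed.

(** Row i of A B is a nonzero multiple of row i of B plus a combination of the
    earlier rows of B, which by induction vanish beyond the diagonal. *)
Lemma trig_mulmx_cancel A B :
  is_trig_mx A -> A \in unitmx -> is_trig_mx (A *m B) -> is_trig_mx B.
Proof.
move=> tA; rewrite trig_unitmx_diag // => /forallP Ad /is_trig_mxP AB0.
have /is_trig_mxP A0 := tA; apply/is_trig_mxP => i j.
have [m] := ubnP (i : nat); elim: m i => // m IH i im ij.
have /eqP := AB0 i j ij; rewrite mxE (bigD1 i) //= big1 => [|k ki].
  by rewrite addr0 mulf_eq0 (negbTE (Ad i)) => /eqP.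
have [ik|] := ltnP i k; first by rewrite A0 ?mul0r.
rewrite leq_eqVlt val_eqE (negbTE ki) /= => {}ki.
rewrite (IH k) ?mulr0 //; last exact: ltn_trans ij.
by rewrite -ltnS (leq_trans _ im).
Qed.

Lemma trig_invmx A : is_trig_mx A -> A \in unitmx -> is_trig_mx (invmx A).
Proof.
move=> tA uA; apply: (trig_mulmx_cancel tA uA).
by rewrite mulmxV // scalar_mx_is_trig.
Qed.

End FiniteTriangular.

Section Leading.
Variable R : realType.
Implicit Types X Y : smx R.

Lemma leading_trig N X : lower_tri X -> is_trig_mx (leading N X).
Proof. by move=> X0; apply/is_trig_mxP => i j ij; rewrite mxE X0. Qed.

Lemma leading_unitmx N X : lower_inv X -> leading N X \in unitmx.
Proof.
move=> [X0 Xd]; rewrite trig_unitmx_diag ?leading_trig //.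
by apply/forallP => i; rewrite mxE.
Qed.

Lemma leading_sid N : leading N (sid R) = 1%:M.
Proof. by apply/matrixP => i j; rewrite !mxE. Qed.

Lemma leading_transp N X : leading N (transp X) = (leading N X)^T.
Proof. by apply/matrixP => i j; rewrite !mxE. Qed.

(** Row i of a lower triangular X stops at column i, so enlarging the block
    adds only zero terms; this is why leading blocks are multiplicative. *)
Lemma leading_sum N X (f : nat -> R) (i : 'I_N) : lower_tri X ->
  \sum_(k < N) X i k * f k = \sum_(k < i.+1) X i k * f k.
Proof.
move=> X0; rewrite [RHS](big_ord_widen N (fun k => X i k * f k)) //.
rewrite [RHS]big_mkcond; apply: eq_bigr => k _; case: ltnP => // ik.
by rewrite X0 ?mul0r.
Qed.

Lemma leading_smul N X Y : lower_tri X ->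
  leading N (smul X Y) = leading N X *m leading N Y.
Proof.
move=> X0; apply/matrixP => i j; rewrite !mxE.
under [RHS]eq_bigr do rewrite !mxE.
rewrite (leading_sum (fun k => Y k j)) //.
by rewrite (@smul_row _ _ _ _ _ 0) addn0 // => k; exact: X0.
Qed.

(** Inverses of nested triangular blocks are nested: the truncated inverse is a
    right inverse of the smaller block.  This makes the entry of [sinv]
    independent of the block in which it is computed. *)
Lemma leading_invmx M N X : lower_inv X -> (M <= N)%N ->
  invmx (leading M.+1 X) =
  \matrix_(i, j) invmx (leading N.+1 X) (inord i) (inord j).
Proof.
move=> iX MN; have [X0 _] := iX; set Z := (RHS).
have XZ : leading M.+1 X *m Z = 1%:M.
  apply/matrixP => i j; rewrite mxE.
  have lN (k : 'I_M.+1) : (k < N.+1)%N by exact: leq_trans (ltn_ord k) _.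
  pose f k := invmx (leading N.+1 X) (inord k) (inord j).
  under eq_bigr do rewrite !mxE.
  rewrite (leading_sum f) //.
  have := @leading_sum N.+1 X f (inord i) X0.
  rewrite !inordK // => <-.
  have := mulmxV (leading_unitmx N.+1 iX).
  move=> /matrixP /(_ (inord i) (inord j)); rewrite !mxE.
  rewrite -val_eqE /= !inordK // => <-.
  by apply: eq_bigr => k _; rewrite /f !mxE inordK // inord_val.
by rewrite -[LHS]mulmx1 -XZ mulKmx ?leading_unitmx.
Qed.

Lemma leading_sinv N X : lower_inv X -> leading N (sinv X) = invmx (leading N X).
Proof.
case: N => [|N] iX; first by apply/matrixP => -[].
apply/matrixP => i j; rewrite mxE /sinv.
rewrite (leading_invmx (N := N)) ?mxE ?inordK ?inord_val //; try lia.
by have := ltn_ord i; have := ltn_ord j; lia.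
Qed.

Lemma smx_leadingP X Y : (forall N, leading N X = leading N Y) -> X = Y.
Proof.
move=> XY; apply/funext => n; apply/funext => k.
have := XY (maxn n k).+1 => /matrixP /(_ (inord n) (inord k)).
by rewrite !mxE !inordK // ltnS ?leq_maxl ?leq_maxr.
Qed.

Lemma lower_tri_sinv X : lower_inv X -> lower_tri (sinv X).
Proof.
move=> iX n k nk; have [X0 _] := iX.
have /is_trig_mxP := trig_invmx (leading_trig (maxn n k).+1 X0) (leading_unitmx _ iX).
by apply; rewrite !inordK ?ltnS ?leq_maxl ?leq_maxr.
Qed.

Lemma smulmV X : lower_inv X -> smul X (sinv X) = sid R.
Proof.
move=> iX; apply: smx_leadingP => N; have [X0 _] := iX.
by rewrite leading_smul // leading_sinv // mulmxV ?leading_unitmx // leading_sid.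
Qed.

Lemma transp_sinv X : transp (sinv X) = sinv (transp X).
Proof.
apply/funext => n; apply/funext => k.
by rewrite /sinv leading_transp -trmx_inv mxE /transp maxnC.
Qed.

Lemma smul_inj X Y Z : lower_inv X -> smul X Y = smul X Z -> Y = Z.
Proof.
move=> iX XYZ; apply: pcol_inj => k; apply/funext.
have rX := lower_tri_row_banded iX.1.
by apply: (act_inj iX) => n; rewrite !act_pcol // XYZ.
Qed.

Lemma act_sinvK (V : lmodType {poly R}) X (v : nat -> V) : lower_inv X ->
  act X (act (sinv X) v) = v.
Proof.
move=> iX; rewrite -act_smul ?smulmV ?act_sid //.
  exact: lower_tri_row_banded iX.1.
exact/lower_tri_row_banded/lower_tri_sinv.
Qed.

End Leading.

Section Functionals.
Variable R : realType.

(** Only the propositional part of the linear structure remains once the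
    underlying functions agree. *)
Lemma mfunctional_ext (f g : mfunctional R) : f =1 g -> f = g.
Proof.
case: f => f [[fa] [fz]]; case: g => g [[ga] [gz]] /funext /= fg.
by subst g; rewrite (Prop_irrelevance fa ga) (Prop_irrelevance fz gz).
Qed.

Section Pairing.
Variables p q : nat.
Implicit Types (Psi : functional_mx R p q).
Implicit Types (S : 'M[{poly R}]_q) (r : 'rV[{poly R}]_q) (c : 'cV[{poly R}]_p).

Lemma lmulfM S S' Psi : lmulf S (lmulf S' Psi) = lmulf (S *m S') Psi.
Proof.
apply/matrixP => j i; rewrite !mxE; apply: mfunctional_ext => f.
rewrite /= /lmulf_entry.
under eq_bigr do rewrite mxE /= /lmulf_entry.
rewrite exchange_big; apply: eq_bigr => l _ /=.
rewrite mxE mulr_suml raddf_sum; apply: eq_bigr => k _ /=.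
by rewrite mulrA [S' k l * _]mulrC.
Qed.

Lemma lmulf1 Psi : lmulf 1%:M Psi = Psi.
Proof.
apply/matrixP => j i; rewrite !mxE; apply: mfunctional_ext => f.
rewrite /= /lmulf_entry (bigD1 j) //= big1 => [|k kj].
  by rewrite mxE eqxx mul1r addr0.
by rewrite mxE eq_sym (negbTE kj) mul0r raddf0.
Qed.

Lemma lmulf_tr S Psi : (lmulf S Psi)^T = rmulf Psi^T S^T.
Proof.
apply/matrixP => i j; rewrite !mxE; apply: mfunctional_ext => f.
by apply: eq_bigr => k _; rewrite !mxE mulrC.
Qed.

Lemma pairing_lmulf S Psi r c : pairing (lmulf S Psi) r c = pairing Psi (r *m S) c.
Proof.
rewrite /pairing.
under eq_bigr do under eq_bigr do rewrite mxE /= /lmulf_entry.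
rewrite [LHS]exchange_big [RHS]exchange_big; apply: eq_bigr => i _ /=.
rewrite exchange_big; apply: eq_bigr => k _ /=.
rewrite mxE mulr_suml raddf_sum; apply: eq_bigr => j _ /=.
by rewrite mulrA [S j k * _]mulrC.
Qed.

Lemma pairing_tr Psi r c : pairing Psi^T c^T r^T = pairing Psi r c.
Proof.
rewrite /pairing exchange_big; apply: eq_bigr => j _; apply: eq_bigr => i _.
by rewrite !mxE mulrC.
Qed.

Lemma pairing_suml (I : finType) Psi (a : I -> R) (r : I -> 'rV[{poly R}]_q) c :
  pairing Psi (\sum_i (a i)%:P *: r i) c = \sum_i a i * pairing Psi (r i) c.
Proof.
rewrite /pairing; under [RHS]eq_bigr do rewrite mulr_sumr.
rewrite [RHS]exchange_big; apply: eq_bigr => j _ /=.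
under [RHS]eq_bigr do rewrite mulr_sumr.
rewrite [RHS]exchange_big; apply: eq_bigr => i _ /=.
rewrite summxE mulr_suml raddf_sum; apply: eq_bigr => k _ /=.
by rewrite mxE -mulrA mul_polyC linearZ.
Qed.

End Pairing.

Definition tra m n (v : nat -> 'M[{poly R}]_(m, n)) := fun k => (v k)^T.

Lemma tra_act m n (v : nat -> 'M[{poly R}]_(m, n)) X : row_banded X ->
  tra (act X v) = act X (tra v).
Proof. by move=> bX; apply/funext => k; exact: (act_linear trmx _ _ bX). Qed.

Lemma traK m n : cancel (@tra m n) (@tra n m).
Proof. by move=> v; apply/funext => k; exact: trmxK. Qed.

Section Gram.
Variables p q : nat.
Implicit Types (Psi : functional_mx R p q) (B : rarray R q) (A : larray R p).

Definition gram Psi B A : smx R := fun n k => pairing Psi (B n) (A k).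

Lemma gram_lmulf S Psi B A :
  gram (lmulf S Psi) B A = gram Psi (fun n => B n *m S) A.
Proof. by apply/funext => n; apply/funext => k; exact: pairing_lmulf. Qed.

(** Recurrences and connection relations for the arrays become matrix
    identities for their Gram matrix. *)
Lemma gram_actl Psi X B A : row_banded X ->
  gram Psi (act X B) A = smul X (gram Psi B A).
Proof.
move=> [w X0]; apply/funext => n; apply/funext => k.
by rewrite /gram (act_row _ (X0 n)) pairing_suml (smul_row _ _ (X0 n)).
Qed.

End Gram.

Lemma gram_tr p q (Psi : functional_mx R p q) B A :
  gram Psi^T (tra A) (tra B) = transp (gram Psi B A).
Proof. by apply/funext => n; apply/funext => k; exact: pairing_tr. Qed.

Lemma gram_actr p q (Psi : functional_mx R p q) X B A : row_banded X ->
  gram Psi B (act X A) = smul (gram Psi B A) (transp X).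
Proof.
move=> bX; have := gram_tr Psi B (act X A).
rewrite tra_act // gram_actl // gram_tr => /(congr1 (@transp R)).
by rewrite transp_smul => /esym.
Qed.

End Functionals.

(** * Step-line arrays and weak normality *)

Section StepLine.
Variable R : realType.

Section StepLineArrays.
Variable q : nat.
Implicit Types B : rarray R q.

(** The degree bounds at position n admit exactly the first n + 1 step-line
    monomials; triangularity of coefficient matrices rests on this. *)
Lemma ltn_slsize n k : (k %/ q < slsize q n (k %% q))%N = (k <= n)%N.
Proof.
rewrite /slsize; have [kn|nk] := leqP k n.
  have := leq_div2r q kn; rewrite leq_eqVlt => /orP[/eqP e|]; last by lia.
  suff -> : (k %% q <= n %% q)%N by rewrite e addn1 ltnS leqnn.
  by move: kn; rewrite {1}(divn_eq k q) {1}(divn_eq n q) e leq_add2l.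
have := leq_div2r q (ltnW nk); rewrite leq_eqVlt => /orP[/eqP e|]; last by lia.
suff -> : (k %% q <= n %% q)%N = false by rewrite e addn0 ltnn.
apply/negbTE; rewrite -ltnNge.
by move: nk; rewrite {1}(divn_eq k q) {1}(divn_eq n q) e ltn_add2l.
Qed.

Lemma leq_slsize m n (s : 'I_q) : (m <= n)%N -> (slsize q m s <= slsize q n s)%N.
Proof.
have q0 : (0 < q)%N by exact: leq_ltn_trans (ltn_ord s).
have sl i u : (u < slsize q i s)%N = (u * q + s <= i)%N.
  by rewrite -[RHS]ltn_slsize divnMDl // divn_small // addn0 modnMDl modn_small.
move=> mn; rewrite leqNgt sl -ltnNge (leq_ltn_trans mn) // ltnNge -sl.
by rewrite ltnn.
Qed.

(** Step-line spaces increase with the position. *)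
Lemma act_lower_stepline X B :
  lower_tri X -> right_stepline B -> right_stepline (act X B).
Proof.
move=> X0 sB n s; rewrite act_lower // summxE.
apply: (leq_trans (size_sum _ _ _)); apply/bigmax_leqP => i _.
rewrite mxE mul_polyC; apply: (leq_trans (size_scale_leq _ _)).
apply: (leq_trans (sB _ _)).
by apply: leq_slsize; rewrite -ltnS.
Qed.

(** Component s of the product only mixes components t with s <= t, whose degree
    bounds are at most that of s. *)
Lemma trig_gauge_stepline B (H : 'M[R]_q) : is_trig_mx H ->
  right_stepline B -> right_stepline (fun n => B n *m map_mx polyC H).
Proof.
move=> /is_trig_mxP H0 sB n s; rewrite mxE.
apply: (leq_trans (size_sum _ _ _)); apply/bigmax_leqP => i _.
rewrite !mxE mulrC mul_polyC.
have [is_|si] := ltnP i s; first by rewrite H0 // scale0r size_poly0.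
apply: (leq_trans (size_scale_leq _ _)); apply: (leq_trans (sB _ _)).
by rewrite /slsize leq_add2l; case: leqP => //; case: leqP => //; lia.
Qed.

Definition initial N B : 'M[{poly R}]_(N, q) := \matrix_(i < N, s < q) B i 0 s.

Lemma initial_act N X B : lower_tri X ->
  initial N (act X B) = map_mx polyC (leading N X) *m initial N B.
Proof.
move=> X0; apply/matrixP => i s; rewrite !mxE act_lower // summxE.
rewrite (big_ord_widen N (fun k => ((X i k)%:P *: B k) 0 s)) // big_mkcond.
apply: eq_bigr => k _; rewrite !mxE; case: ltnP => // ik.
by rewrite X0 ?mul0r.
Qed.

Lemma initial_scale N (c : {poly R}) B :
  initial N (fun n => c *: B n) = c *: initial N B.
Proof. by apply/matrixP => i s; rewrite !mxE. Qed.

Lemma initial_mulmx N B S : initial N (fun n => B n *m S) = initial N B *m S.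
Proof.
by apply/matrixP => i s; rewrite !mxE; apply: eq_bigr => k _; rewrite !mxE.
Qed.

End StepLineArrays.

Section Coefficients.
Variables (q : nat) (hq : (0 < q)%N).
Implicit Types B : rarray R q.

(** Position k of the step-line carries the monomial of degree k %/ q in
    component k %% q. *)
Definition stepcoef B : smx R :=
  fun n k => (B n 0 (Ordinal (ltn_pmod k hq)))`_(k %/ q).

Definition stepmono : rarray R q :=
  fun k => 'X^(k %/ q) *: delta_mx 0 (Ordinal (ltn_pmod k hq)).

Lemma stepcoef_lower B : right_stepline B -> lower_tri (stepcoef B).
Proof.
move=> sB n k nk; apply/nth_default/(leq_trans (sB _ _)).
by rewrite leqNgt ltn_slsize -ltnNge.
Qed.

Lemma act_stepcoef B : right_stepline B -> act (stepcoef B) stepmono = B.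
Proof.
move=> sB; apply/funext => n; have cB := stepcoef_lower sB.
apply/rowP => s; apply/polyP => u.
(* The step-line position of the monomial of degree u in component s. *)
pose k := (u * q + s)%N.
have ku : (k %/ q)%N = u by rewrite divnMDl // divn_small ?addn0.
have ks : (k %% q)%N = s by rewrite modnMDl modn_small.
have kE i : (i == k) = ((i %/ q == u) && (i %% q == s))%N.
  apply/eqP/andP => [->|[/eqP iu /eqP i_s]]; first by rewrite ku ks.
  by rewrite (divn_eq i q) iu i_s.
have es : Ordinal (ltn_pmod k hq) = s by apply: val_inj.
have Bk : stepcoef B n k = (B n 0 s)`_u by rewrite /stepcoef ku es.
pose N := (n + k).+1.
have -> : act (stepcoef B) stepmono n =
    \sum_(i < N) (stepcoef B n i)%:P *: stepmono i.
  by apply: fsum_nat => i ni; rewrite cB ?scale0r //; move: ni; rewrite /N; lia.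
rewrite summxE coef_sum -Bk.
have kN : (k < N)%N by rewrite /N; lia.
rewrite (bigD1 (Ordinal kN)) //= big1 => [|i].
  by rewrite !mxE coefCM es ku !eqxx mulr1 coefXn eqxx mulr1 addr0.
rewrite -val_eqE /= kE => ik.
rewrite !mxE coefCM /=.
case: (s =P Ordinal (ltn_pmod i hq)) ik => [-> /=|_ _]; last by rewrite mulr0 coef0 mulr0.
by rewrite eqxx andbT mulr1 coefXn eq_sym => /negbTE ->; rewrite mulr0.
Qed.

(** The first q positions have degree bound 0 or -1, so these entries are
    constants: the right initial condition is a block of coefficients. *)
Lemma initial_stepcoef B : right_stepline B ->
  initial q B = map_mx polyC (leading q (stepcoef B)).
Proof.
move=> sB; apply/matrixP => i s; rewrite !mxE /stepcoef divn_small //.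
have -> : Ordinal (ltn_pmod s hq) = s by apply: val_inj; rewrite /= modn_small.
apply/size1_polyC/(leq_trans (sB _ _)).
by rewrite /slsize divn_small // add0n leq_b1.
Qed.

End Coefficients.

Lemma gram_stepmono p q (hp : (0 < p)%N) (hq : (0 < q)%N)
    (Psi : functional_mx R p q) :
  gram Psi (stepmono hq) (tra (stepmono hp)) = stepline_moments hp hq Psi.
Proof.
apply/funext => n; apply/funext => k.
rewrite /gram /pairing /stepline_moments.
set j0 := Ordinal (ltn_pmod n hq); set i0 := Ordinal (ltn_pmod k hp).
rewrite (bigD1 j0) //= (bigD1 i0) //= !big1 => [|j jj|i ii].
- by rewrite !mxE !eqxx !mulr1 !addr0 -exprD.
- by rewrite big1 // => i _; rewrite !mxE eqxx (negbTE jj) mulr0 mul0r raddf0.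
- by rewrite !mxE eqxx (negbTE ii) !mulr0 raddf0.
Qed.

Lemma left_steplineP p (A : larray R p) : left_stepline A <-> right_stepline (tra A).
Proof. by split=> sA n s; have := sA n s; rewrite mxE. Qed.

Lemma map_polyC_mx_inj m n : injective (@map_mx R {poly R} polyC m n).
Proof.
move=> X Y /matrixP XY; apply/matrixP => i j.
by have := XY i j; rewrite !mxE => /polyC_inj.
Qed.

Section Biorthogonal.
Variables (p q : nat) (hp : (0 < p)%N) (hq : (0 < q)%N).
Implicit Types (B : rarray R q) (A : larray R p) (Psi : functional_mx R p q).

(** The full Gram matrix is b M a^T.  As b is lower and a^T upper triangular,
    truncation of the outer factors commutes with the product. *)
Lemma leading_gram N Psi B A : right_stepline B -> left_stepline A ->
  leading N (gram Psi B A) = leading N (stepcoef hq B)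
    *m leading N (stepline_moments hp hq Psi)
    *m (leading N (stepcoef hp (tra A)))^T.
Proof.
move=> sB /left_steplineP sA.
have cB := stepcoef_lower hq sB; have cA := stepcoef_lower hp sA.
have rA := lower_tri_row_banded cA.
have eA : A = act (stepcoef hp (tra A)) (tra (stepmono hp)).
  by rewrite -tra_act // act_stepcoef // traK.
have -> : gram Psi B A = smul (stepcoef hq B)
    (smul (stepline_moments hp hq Psi) (transp (stepcoef hp (tra A)))).
  rewrite [in LHS]eA -[in LHS](act_stepcoef hq sB).
  rewrite gram_actl; last exact: lower_tri_row_banded.
  by rewrite gram_actr // gram_stepmono.
rewrite leading_smul // -mulmxA; congr (_ *m _).
rewrite -[smul _ _]/(transp (transp _)) transp_smul leading_transp.
by rewrite leading_smul // trmx_mul leading_transp trmxK.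
Qed.

(** The leading block of b M a^T is the identity, so each square factor is
    invertible. *)
Lemma biorthogonal_unitmx N Psi B A : right_stepline B -> left_stepline A ->
  gram Psi B A = sid R ->
  (leading N (stepcoef hq B) \in unitmx) /\
  (leading N (stepline_moments hp hq Psi) \in unitmx).
Proof.
move=> sB sA BA; have := leading_gram N Psi sB sA.
rewrite BA leading_sid -mulmxA => e; have [uB _] := mulmx1_unit (esym e).
split=> //; move: e; rewrite mulmxA => /esym /mulmx1_unit [].
by rewrite unitmx_mul uB.
Qed.

Lemma initial_nonsing Psi B A (xi : 'M[R]_q) :
  right_stepline B -> left_stepline A -> gram Psi B A = sid R ->
  initial q B = map_mx polyC xi -> nonsing_lower xi.
Proof.
move=> sB sA BA; rewrite (initial_stepcoef hq) // => /map_polyC_mx_inj <-.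
split; first exact/leading_trig/stepcoef_lower.
by have [] := biorthogonal_unitmx q sB sA BA.
Qed.

(** Every system below is recognised through this criterion: weak normality is
    a consequence of biorthogonality. *)
Lemma biorthogonal_wn_system T xi nu B A Psi :
  right_stepline B -> left_stepline A -> right_array T xi B -> left_array T nu A ->
  gram Psi B A = sid R -> wn_system hp hq T xi nu B A Psi.
Proof.
move=> sB sA rB lA BA; split=> // [N|n k].
  by have [_] := biorthogonal_unitmx N sB sA BA; rewrite unitmxE unitfE.
by rewrite -[LHS]/(gram Psi B A n k) BA.
Qed.

Lemma wn_system_gram T xi nu B A Psi :
  wn_system hp hq T xi nu B A Psi -> gram Psi B A = sid R.
Proof.
by case=> _ _ _ _ _ BA; apply/funext => n; apply/funext => k; exact: BA.
Qed.

Lemma wn_system_nonsing T xi nu B A Psi :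
  wn_system hp hq T xi nu B A Psi -> nonsing_lower xi.
Proof.
move=> wn; have BA := wn_system_gram wn; have [_ sB sA [_ xiB] _ _] := wn.
exact: initial_nonsing BA xiB.
Qed.

End Biorthogonal.
End StepLine.

(** * Biorthogonal systems and the composite transformation *)

Section Circuit.
Variable R : realType.

Lemma mulTB_act q X (B : rarray R q) : mulTB X B = act X B.
Proof. by []. Qed.

Lemma mulAT_act p X (A : larray R p) : mulAT A X = act (transp X) A.
Proof. by []. Qed.

Lemma right_arrayP q T xi (B : rarray R q) :
  right_array T xi B <->
  act T B = (fun n => 'X *: B n) /\ initial q B = map_mx polyC xi.
Proof. by split=> -[TB xiB]; split=> //; [apply/funext | move=> n; rewrite mulTB_act TB]. Qed.

Lemma left_array_tr p T nu (A : larray R p) : row_banded (transp T) ->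
  left_array T nu A <-> right_array (transp T) nu (tra A).
Proof.
move=> bT; rewrite right_arrayP -tra_act //.
split=> -[TA nuA]; split.
- by apply/funext => n; rewrite /tra -mulAT_act TA linearZ.
- apply: trmx_inj; rewrite map_trmx -nuA.
  by apply/matrixP => i s; rewrite !mxE.
- move=> n; have /(congr1 (fun v => (v n)^T)) := TA.
  by rewrite /tra linearZ /= !trmxK.
- apply: trmx_inj; rewrite -map_trmx trmxK -nuA.
  by apply/matrixP => i s; rewrite !mxE.
Qed.

Section Transpose.
Variables (p q : nat) (hp : (0 < p)%N) (hq : (0 < q)%N).

(** Exchanges the roles of the two arrays; the statements on left arrays and on
    lower factors are obtained through it.  Weak normality of the transposed
    functional comes from its biorthogonality. *)
Lemma wn_system_tr T xi nu B A (Psi : functional_mx R p q) :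
  row_banded T -> row_banded (transp T) ->
  wn_system hp hq T xi nu B A Psi ->
  wn_system hq hp (transp T) nu xi (tra A) (tra B) Psi^T.
Proof.
move=> bT bT' wn; have BA := wn_system_gram wn; have [_ sB sA rB lA _] := wn.
apply: biorthogonal_wn_system.
- exact/left_steplineP.
- by apply/left_steplineP; rewrite traK.
- exact/left_array_tr.
- by apply/left_array_tr => //; rewrite traK.
- by rewrite gram_tr BA transp_sid.
Qed.

End Transpose.

Section Systems.
Variables (p q : nat) (hp : (0 < p)%N) (hq : (0 < q)%N).
Implicit Types (B : rarray R q) (A : larray R p) (Psi : functional_mx R p q).
Implicit Types (T X Y : smx R).

(** Multiplication by x on the right array is multiplication by T on the Gram
    matrix, which starts at the identity. *)
Lemma gram_pow T B A Psi n : row_banded T ->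
  act T B = (fun i => 'X *: B i) -> gram Psi B A = sid R ->
  gram Psi (fun i => 'X^n *: B i) A = sexp T n.
Proof.
move=> bT TB BA; elim: n => [|n IH].
  by rewrite /sexp /= -BA; congr (gram _ _ _); apply/funext => i; rewrite expr0 scale1r.
have -> : (fun i => 'X^(n.+1) *: B i) = act T (fun i => 'X^n *: B i).
  by rewrite act_scale // TB; apply/funext => i; rewrite exprSr -scalerA.
by rewrite gram_actl // IH.
Qed.

(** The first q rows of B and p columns of A are the constants xi and nu^T, so
    the corner of the Gram matrix of x^n B and A is xi (moment n) nu^T, while
    [gram_pow] identifies it with the corner of T^n. *)
Lemma wn_system_represents T xi nu B A Psi :
  row_banded T -> xi \in unitmx -> nu \in unitmx ->
  wn_system hp hq T xi nu B A Psi -> represents T xi nu Psi.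
Proof.
move=> bT uxi unu wn n; have BA := wn_system_gram wn.
have [_ _ _ /right_arrayP[TB xiB] [_ nuA] _] := wn.
suff e : corner q p (sexp T n) = xi *m moment Psi n *m nu^T.
  by rewrite /attached_moment e -!mulmxA trmx_inv mulmxV ?unitmx_tr // mulmx1 mulKmx.
apply/matrixP => i j; rewrite mxE -(gram_pow n bT TB BA) /gram /pairing.
have Bi k : B i 0 k = (xi i k)%:P.
  by have /matrixP /(_ i k) := xiB; rewrite !mxE.
have Aj k : A j k 0 = (nu j k)%:P.
  by have /matrixP /(_ k j) := nuA; rewrite !mxE.
rewrite mxE; under [RHS]eq_bigr do rewrite !mxE mulr_suml.
rewrite [RHS]exchange_big; apply: eq_bigr => k _; apply: eq_bigr => l _ /=.
rewrite !mxE Bi Aj -mulrA -polyCM mulrC mul_polyC linearZ /=.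
by rewrite mulrAC.
Qed.

Lemma wn_system_gauge T xi nu B A Psi (H : 'M[R]_q) : row_banded T ->
  is_trig_mx H ->
  wn_system hp hq T xi nu B A (lmulf (map_mx polyC H) Psi) ->
  wn_system hp hq T (xi *m H) nu (fun n => B n *m map_mx polyC H) A Psi.
Proof.
move=> bT tH wn; have BA := wn_system_gram wn.
have [_ sB sA /right_arrayP[TB xiB] lA _] := wn.
apply: biorthogonal_wn_system => //; first exact: trig_gauge_stepline.
  apply/right_arrayP; split; last by rewrite initial_mulmx xiB map_mxM.
  apply/funext => n; have := act_linear (mulmxr (map_mx polyC H)) B n bT.
  by rewrite TB /= scalemxAl => <-.
by rewrite -gram_lmulf.
Qed.

(** The effect of all moves at once: X collects the factors that stay and Y those
    that move.  The chain of moves enters through its composite relations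
    Y B0 = B S and A Y = A0. *)
Lemma circuit X Y T xi0 nu0 B0 A0 Psi xi B A S :
  lower_inv X -> row_banded (transp X) ->
  lower_inv (transp Y) -> row_banded Y ->
  wn_system hp hq (smul X Y) xi0 nu0 B0 A0 Psi ->
  T = smul Y X ->
  nonsing_lower xi -> right_array T xi B -> right_stepline B ->
  (forall n, act Y B0 n = B n *m S) ->
  left_stepline A -> act (transp Y) A = A0 ->
  exists H : 'M[R]_q,
    [/\ nonsing_lower H, S = 'X *: map_mx polyC H
      & exists nu : 'M[R]_p,
        [/\ nonsing_lower nu,
            wn_system hp hq T xi nu B A (lmulf S Psi)
          & wn_system hp hq T (xi *m H) nu
              (fun n => B n *m map_mx polyC H) A (lmulf 'X%:M Psi)]].
Proof.
move=> iX bX' iY' bY wn0 -> [txi uxi] /right_arrayP[TB xiB] sB YB sA YA.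
have bX := lower_tri_row_banded iX.1; have bY' := lower_tri_row_banded iY'.1.
have bT' : row_banded (transp (smul Y X)).
  by rewrite transp_smul; exact: row_banded_smul.
have bT : row_banded (smul Y X) by exact: row_banded_smul.
have BA0 := wn_system_gram wn0; have [txi0 uxi0] := wn_system_nonsing wn0.
have [_ sB0 sA0 /right_arrayP[TB0 xiB0] [TA0 _] _] := wn0.
have {}YB : act Y B0 = (fun n => B n *m S) by exact/funext.
pose P := leading q X *m xi; pose H := invmx P *m xi0.
have uP : P \in unitmx by rewrite unitmx_mul leading_unitmx.
(* The first q rows of X Y B0 = x B0, where Y B0 = B S. *)
have PS : map_mx polyC P *m S = 'X *: map_mx polyC xi0.
  rewrite -xiB0 -initial_scale -TB0 act_smul // initial_act; last exact: iX.1.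
  by rewrite YB initial_mulmx xiB mulmxA -map_mxM.
have SE : S = 'X *: map_mx polyC H.
  rewrite map_mxM scalemxAr -PS mulmxA -map_mxM mulVmx //.
  by rewrite map_mx1 mul1mx.
have nH : nonsing_lower H.
  split; last by rewrite unitmx_mul unitmx_inv uP.
  apply: trig_mulmx => //; apply: trig_invmx => //; apply: trig_mulmx => //.
  exact/leading_trig/iX.1.
(* Both sides agree after multiplication by Y on the right, which is injective. *)
have TA : act (transp (smul Y X)) A = (fun n => 'X *: A n).
  rewrite transp_smul act_smul // YA; apply/funext; apply: (act_inj iY') => n.
  by rewrite -act_smul // -transp_smul act_scale // YA -TA0.
pose nu := leading p (stepcoef hp (tra A)).
have sA' : right_stepline (tra A) by exact/left_steplineP.
have nuA : initial p (tra A) = map_mx polyC nu by exact: initial_stepcoef.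
have lA : left_array (smul Y X) nu A.
  apply/left_array_tr => //; apply/right_arrayP; split=> //.
  by rewrite -tra_act // TA; apply/funext => n; rewrite /tra linearZ.
have BA : gram (lmulf S Psi) B A = sid R.
  rewrite gram_lmulf -YB.
  (* Pairing Y B0 with A Y = A0 gives Y; cancelling Y leaves the identity. *)
  have QY : smul (gram Psi (act Y B0) A) Y = Y.
    rewrite -[X in smul _ X]/(transp (transp Y)) -gram_actr // YA.
    by rewrite gram_actl // BA0 smulm1.
  have := congr1 (@transp R) QY.
  rewrite transp_smul -{2}[transp Y]smulm1 => /(smul_inj iY').
  by move=> /(congr1 (@transp R)); rewrite transp_sid.
have wn : wn_system hp hq (smul Y X) xi nu B A (lmulf S Psi).
  by apply: biorthogonal_wn_system => //; exact/right_arrayP.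
exists H; split=> //; exists nu; split=> //.
  apply: (initial_nonsing (Psi := (lmulf S Psi)^T) (A := tra B) hq hp sA' _ _ nuA).
    by apply/left_steplineP; rewrite traK.
  by rewrite gram_tr BA transp_sid.
apply: wn_system_gauge => //; first by have [] := nH.
by rewrite lmulfM mul_mx_scalar -SE.
Qed.

End Systems.
End Circuit.

(** * Words of bidiagonal factors and the upper circuit *)

Section Words.
Variable R : realType.
Implicit Types (F W : nat -> smx R).

Lemma smul_prod_ind (K : smx R -> Prop) F m n :
  K (sid R) -> (forall X Y, K X -> K Y -> K (smul X Y)) ->
  (forall i, (m <= i < n)%N -> K (F i)) ->
  K (\big[@smul R/sid R]_(m <= i < n) F i).
Proof.
move=> K1 KM KF; rewrite big_nat; elim/big_ind: _ => //.
Qed.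

Lemma row_banded_sid : row_banded (sid R).
Proof. exact/lower_tri_row_banded/lower_tri_sid. Qed.

Lemma lower_inv_sid : lower_inv (sid R).
Proof.
by split=> [|n]; [exact: lower_tri_sid | rewrite /sid eqxx oner_neq0].
Qed.

Lemma row_banded_prod F m n : (forall i, (m <= i < n)%N -> row_banded (F i)) ->
  row_banded (\big[@smul R/sid R]_(m <= i < n) F i).
Proof.
by apply: smul_prod_ind; [exact: row_banded_sid | exact: row_banded_smul].
Qed.

Lemma row_banded_transp_prod F m n :
  (forall i, (m <= i < n)%N -> row_banded (transp (F i))) ->
  row_banded (transp (\big[@smul R/sid R]_(m <= i < n) F i)).
Proof.
apply: (smul_prod_ind (K := fun X => row_banded (transp X))) => [|X Y bX bY].
  by rewrite transp_sid; exact: row_banded_sid.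
by rewrite transp_smul; exact: row_banded_smul.
Qed.

Lemma lower_inv_prod F m n : (forall i, (m <= i < n)%N -> lower_inv (F i)) ->
  lower_inv (\big[@smul R/sid R]_(m <= i < n) F i).
Proof.
by apply: smul_prod_ind; [exact: lower_inv_sid | exact: lower_inv_smul].
Qed.

Lemma lower_inv_transp_prod F m n :
  (forall i, (m <= i < n)%N -> lower_inv (transp (F i))) ->
  lower_inv (transp (\big[@smul R/sid R]_(m <= i < n) F i)).
Proof.
apply: (smul_prod_ind (K := fun X => lower_inv (transp X))) => [|X Y iX iY].
  by rewrite transp_sid; exact: lower_inv_sid.
by rewrite transp_smul; exact: lower_inv_smul.
Qed.

Lemma smul_prod_cat F m k n : (m <= k <= n)%N ->
  (forall i, (m <= i < k)%N -> row_banded (F i)) ->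
  \big[@smul R/sid R]_(m <= i < n) F i =
  smul (\big[@smul R/sid R]_(m <= i < k) F i)
       (\big[@smul R/sid R]_(k <= i < n) F i).
Proof.
move=> /andP[]; move: {2}(k - m)%N (erefl (k - m)%N) => d.
elim: d m => [|d IH] m km mk kn bF.
  have -> : m = k by lia.
  by rewrite [X in smul X _]big_geq ?smul1m.
have mk' : (m < k)%N by lia.
rewrite (big_ltn (leq_trans mk' kn)) [in RHS](big_ltn mk') IH; try lia.
  rewrite smulA //; first by apply: bF; lia.
  by apply: row_banded_prod => i ik; apply: bF; lia.
by move=> i ik; apply: bF; lia.
Qed.

Lemma smul_prod1 F m : \big[@smul R/sid R]_(m <= i < m.+1) F i = F m.
Proof. by rewrite big_ltn // big_geq // smulm1. Qed.

Lemma UprodS n W : Uprod n.+1 W = smul (W n.+1) (Uprod n W).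
Proof. by rewrite /Uprod big_nat_recl // subn0; under eq_bigr do rewrite subSS. Qed.

Lemma Lprod_recr n F : (forall i, (1 <= i <= n)%N -> row_banded (F i)) ->
  Lprod n.+1 F = smul (Lprod n F) (F n.+1).
Proof.
by move=> bF; rewrite /Lprod (@smul_prod_cat _ _ n.+1) ?smul_prod1 //; lia.
Qed.

Lemma transp_Lprod n F : (forall i, (1 <= i <= n)%N -> row_banded (F i)) ->
  transp (Lprod n F) = Uprod n (fun i => transp (F i)).
Proof.
elim: n => [|n IH] bF; first by rewrite /Lprod /Uprod !big_geq ?transp_sid.
have bF' i : (1 <= i <= n)%N -> row_banded (F i) by move=> i_n; apply: bF; lia.
by rewrite UprodS Lprod_recr // transp_smul IH.
Qed.

Lemma pos_lower_inv (X : smx R) : pos_lower X -> lower_inv X /\ row_banded (transp X).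
Proof.
move=> [X1 _ X0]; split; last first.
  by exists 1%N => n k nk; apply: X0; lia.
by split=> [n k nk|n]; [apply: X0; lia | rewrite X1 oner_neq0].
Qed.

Lemma pos_upper_inv (X : smx R) : pos_upper X -> lower_inv (transp X) /\ row_banded X.
Proof.
move=> [_ Xd X0]; split; last first.
  by exists 1%N => n k nk; apply: X0; lia.
by split=> [n k nk|n]; [apply: X0; lia | rewrite gt_eqF ?Xd].
Qed.

End Words.

Section Chains.
Variables (R : realType) (p q : nat).
Implicit Types (W : nat -> smx R).

Lemma prod_revS n (S : nat -> 'M[{poly R}]_q) :
  \prod_(0 <= j < n.+1) S (n.+1 - j)%N =
  S n.+1 *m \prod_(0 <= j < n) S (n - j)%N.
Proof. by rewrite big_nat_recl // subn0; under eq_bigr do rewrite subSS. Qed.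

(** Each move multiplies the accumulated upper factor on the left and the
    accumulated connection matrix on the left as well, because the latter acts
    on the right of the array. *)
Lemma right_chain n W (B : nat -> rarray R q) S :
  (forall j, (1 <= j <= n)%N -> row_banded (W j)) ->
  (forall j, (1 <= j <= n)%N -> forall k, act (W j) (B j.-1) k = B j k *m S j) ->
  act (Uprod n W) (B 0%N) = (fun k => B n k *m \prod_(0 <= j < n) S (n - j)%N).
Proof.
elim: n => [|n IH] bW WB.
  apply/funext => k; rewrite /Uprod !big_geq // act_sid.
  by rewrite -[1]/(1%:M) mulmx1.
have bW' j : (1 <= j <= n)%N -> row_banded (W j) by move=> jn; apply: bW; lia.
have WB' j : (1 <= j <= n)%N -> forall k, act (W j) (B j.-1) k = B j k *m S j.
  by move=> jn; apply: WB; lia.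
have bU : row_banded (Uprod n W).
  by apply: row_banded_prod => i ik; apply: bW; lia.
have bn : row_banded (W n.+1) by apply: bW; lia.
rewrite UprodS act_smul // IH // prod_revS; apply/funext => k.
set P := \prod_(0 <= j < n) _; rewrite mulmxA -WB ?leqnn //=.
exact/esym/(act_linear (mulmxr P) (B n) k bn).
Qed.

(** Step-line degrees survive because the inverse of an upper triangular factor
    is upper triangular: column n of A U^-1 involves columns k <= n of A. *)
Lemma left_chain n W (A : nat -> larray R p) :
  (forall j, (1 <= j <= n)%N -> lower_inv (transp (W j))) ->
  (forall j, (1 <= j <= n)%N -> A j = act (transp (sinv (W j))) (A j.-1)) ->
  left_stepline (A 0%N) ->
  left_stepline (A n) /\ act (transp (Uprod n W)) (A n) = A 0%N.
Proof.
elim: n => [|n IH] iW WA sA; first by rewrite /Uprod big_geq // transp_sid act_sid.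
have iW' j : (1 <= j <= n)%N -> lower_inv (transp (W j)) by move=> jn; apply: iW; lia.
have WA' j : (1 <= j <= n)%N -> A j = act (transp (sinv (W j))) (A j.-1).
  by move=> jn; apply: WA; lia.
have [sn An] := IH iW' WA' sA.
have iUn : lower_inv (transp (W n.+1)) by apply: iW; lia.
have AS : A n.+1 = act (sinv (transp (W n.+1))) (A n).
  by rewrite (WA n.+1) ?leqnn // transp_sinv.
split.
  apply/left_steplineP; rewrite AS tra_act; last first.
    exact: lower_tri_row_banded (lower_tri_sinv iUn).
  apply: act_lower_stepline; first exact: lower_tri_sinv iUn.
  exact/left_steplineP.
rewrite UprodS transp_smul act_smul; first by rewrite AS act_sinvK.
- suff [] : lower_inv (transp (Uprod n W)) by move=> + _; exact: lower_tri_row_banded.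
  by apply: lower_inv_transp_prod => i ik; apply: iW; lia.
- exact: lower_tri_row_banded iUn.1.
Qed.

Lemma functional_chain n (S : nat -> 'M[{poly R}]_q) (Psi : nat -> functional_mx R p q) :
  (forall j, (1 <= j <= n)%N -> Psi j = lmulf (S j) (Psi j.-1)) ->
  Psi n = lmulf (\prod_(0 <= j < n) S (n - j)%N) (Psi 0%N).
Proof.
elim: n => [|n IH] SPsi; first by rewrite big_geq // -[1]/(1%:M) lmulf1.
rewrite SPsi ?leqnn //= IH; last by move=> j jn; apply: SPsi; lia.
by rewrite lmulfM prod_revS.
Qed.

End Chains.

Section RightCircuit.
Variables (R : realType) (p q : nat) (hp : (0 < p)%N) (hq : (0 < q)%N).

(** The moves W_1, ..., W_n amount to one application of [circuit] with
    Y = W_n ... W_1; the gauge H^-1 then turns the factor x H into x. *)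
Lemma right_circuit n X W T xi nu0 (xi0 : 'M[R]_q) (B : nat -> rarray R q)
    (A : nat -> larray R p) (Psi : nat -> functional_mx R p q) S :
  lower_inv X -> row_banded (transp X) ->
  (forall j, (1 <= j <= n)%N -> lower_inv (transp (W j)) /\ row_banded (W j)) ->
  T = smul (Uprod n W) X ->
  wn_system hp hq (smul X (Uprod n W)) xi0 nu0 (B 0%N) (A 0%N) (Psi 0%N) ->
  nonsing_lower xi -> right_array T xi (B n) -> right_stepline (B n) ->
  (forall j, (1 <= j <= n)%N -> forall k, mulTB (W j) (B j.-1) k = B j k *m S j) ->
  (forall j, (1 <= j <= n)%N -> A j = mulAT (A j.-1) (sinv (W j))) ->
  (forall j, (1 <= j <= n)%N -> Psi j = lmulf (S j) (Psi j.-1)) ->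
  exists H : 'M[R]_q,
    [/\ nonsing_lower H,
        \prod_(0 <= j < n) S (n - j)%N = 'X *: map_mx polyC H,
        Psi n = lmulf ('X *: map_mx polyC H) (Psi 0%N),
        lmulf (map_mx polyC (invmx H)) (Psi n) = lmulf 'X%:M (Psi 0%N)
      & exists nu : 'M[R]_p,
        [/\ nonsing_lower nu,
            wn_system hp hq T xi nu (B n) (A n) (Psi n)
          & wn_system hp hq T (xi *m H) nu
              (fun k => B n k *m map_mx polyC H) (A n) (lmulf 'X%:M (Psi 0%N))]].
Proof.
move=> iX bX' hW TE wn0 nxi rB sB WB WA SPsi.
have iW j : (1 <= j <= n)%N -> lower_inv (transp (W j)) by case/hW.
have bW j : (1 <= j <= n)%N -> row_banded (W j) by case/hW.
have [_ _ sA0 _ _ _] := wn0.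
have [sA YA] := left_chain iW WA sA0.
have YB := right_chain bW WB.
have PsiE := functional_chain SPsi.
set P := \prod_(0 <= j < n) _ in YB PsiE *.
have iY : lower_inv (transp (Uprod n W)).
  by apply: lower_inv_transp_prod => i ik; apply: iW; lia.
have bY : row_banded (Uprod n W).
  by apply: row_banded_prod => i ik; apply: bW; lia.
have [H [nH PE [nu [nnu wn wnH]]]] :=
  circuit iX bX' iY bY wn0 TE nxi rB sB (fun k => congr1 (fun f => f k) YB) sA YA.
exists H; split; [by [] | by [] | by rewrite -PE | |].
  rewrite PsiE PE lmulfM -scalemxAr -map_mxM mulVmx; last by have [] := nH.
  by rewrite map_mx1 scalemx1.
by exists nu; split=> //; rewrite PsiE.
Qed.

End RightCircuit.

(** * The lower circuit and the cyclic word *)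

Section LeftCircuit.
Variables (R : realType) (p q : nat) (hp : (0 < p)%N) (hq : (0 < q)%N).

Lemma rmulf_tr (Psi : functional_mx R p q) C : (rmulf Psi C)^T = lmulf C^T Psi^T.
Proof. by apply: trmx_inj; rewrite lmulf_tr !trmxK. Qed.

Lemma trmx_prod_rev n (C : nat -> 'M[{poly R}]_p) :
  (\prod_(1 <= a < n.+1) C a)^T = \prod_(0 <= j < n) (C (n - j)%N)^T.
Proof.
elim: n => [|n IH]; first by rewrite !big_geq // -[1]/(1%:M) tr_scalar_mx.
by rewrite (prod_revS n (fun a => (C a)^T)) big_nat_recr //= -mulmxE trmx_mul IH.
Qed.

(** Mirror image of [right_circuit]: the matrix at the start is
    (V_1 ... V_n) Y, with transpose Y^T V_n^T ... V_1^T, in which Y^T stays and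
    the factors V_a^T move; left arrays become right arrays and C_a becomes its
    transpose. *)
Lemma left_circuit n Y V T (xi0 : 'M[R]_q) nu0 nu (B : nat -> rarray R q)
    (A : nat -> larray R p) (Psi : nat -> functional_mx R p q) C :
  lower_inv (transp Y) -> row_banded Y ->
  (forall a, (1 <= a <= n)%N -> lower_inv (V a) /\ row_banded (transp (V a))) ->
  T = smul Y (Lprod n V) ->
  wn_system hp hq (smul (Lprod n V) Y) xi0 nu0 (B 1%N) (A 1%N) (Psi 1%N) ->
  nonsing_lower nu -> left_array T nu (A n.+1) -> left_stepline (A n.+1) ->
  (forall a, (1 <= a <= n)%N -> forall k, mulAT (A a) (V a) k = C a *m A a.+1 k) ->
  (forall a, (1 <= a <= n)%N -> B a.+1 = mulTB (sinv (V a)) (B a)) ->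
  (forall a, (1 <= a <= n)%N -> Psi a.+1 = rmulf (Psi a) (C a)) ->
  exists K : 'M[R]_p,
    [/\ nonsing_upper K,
        \prod_(1 <= a < n.+1) C a = 'X *: map_mx polyC K,
        Psi n.+1 = rmulf (Psi 1%N) ('X *: map_mx polyC K),
        rmulf (Psi n.+1) (map_mx polyC (invmx K)) = rmulf (Psi 1%N) 'X%:M
      & exists xi : 'M[R]_q,
        [/\ nonsing_lower xi,
            wn_system hp hq T xi nu (B n.+1) (A n.+1) (Psi n.+1)
          & wn_system hp hq T xi (nu *m K^T) (B n.+1)
              (fun k => map_mx polyC K *m A n.+1 k) (rmulf (Psi 1%N) 'X%:M)]].
Proof.
move=> iY bY hV TE wn0 nnu lA sA VA VB CPsi.
have bV a : (1 <= a <= n)%N -> row_banded (V a).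
  by move=> /hV[[V0 _] _]; exact: lower_tri_row_banded.
have bLp : row_banded (Lprod n V).
  by apply: row_banded_prod => i ik; apply: bV; lia.
have bLp' : row_banded (transp (Lprod n V)).
  by apply: row_banded_transp_prod => i ik; case: (hV i); first by lia.
have bY' := lower_tri_row_banded iY.1.
have LpE := transp_Lprod bV.
have bT : row_banded T by rewrite TE; exact: row_banded_smul.
have bT' : row_banded (transp T) by rewrite TE transp_smul; exact: row_banded_smul.
have bLY : row_banded (smul (Lprod n V) Y) by exact: row_banded_smul.
have bLY' : row_banded (transp (smul (Lprod n V) Y)).
  by rewrite transp_smul; exact: row_banded_smul.
have wn0' := wn_system_tr bLY bLY' wn0.
rewrite transp_smul LpE in wn0'.
(* Stages of the lower circuit are numbered from 1, those of [right_circuit] from 0. *)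
have [|||||||||K [nK PE PsiE gPsi [xi [nxi wn wnK]]]] :=
  @right_circuit R q p hq hp n (transp Y) (fun a => transp (V a)) (transp T)
    nu xi0 nu0 (fun j => tra (A j.+1)) (fun j => tra (B j.+1))
    (fun j => (Psi j.+1)^T) (fun a => (C a)^T) iY bY.
- by [].
- by rewrite TE transp_smul LpE.
- exact: wn0'.
- exact: nnu.
- exact/left_array_tr.
- exact/left_steplineP.
- move=> j jn k; have j1 : j.-1.+1 = j by rewrite prednK //; case/andP: jn.
  rewrite j1 mulTB_act -tra_act; last by case: (hV _ jn).
  by rewrite /tra -mulAT_act VA // trmx_mul.
- move=> j jn; have j1 : j.-1.+1 = j by rewrite prednK //; case/andP: jn.
  have [iV _] := hV _ jn.
  rewrite j1 VB // mulAT_act mulTB_act tra_act ?transp_sinv //.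
  exact: lower_tri_row_banded (lower_tri_sinv iV).
- move=> j jn; have j1 : j.-1.+1 = j by rewrite prednK //; case/andP: jn.
  by rewrite j1 CPsi // rmulf_tr.
have [tK uK] := nK.
exists K^T; split.
- by split; rewrite ?trmxK ?unitmx_tr.
- by apply: trmx_inj; rewrite trmx_prod_rev PE linearZ /= map_trmx trmxK.
- by apply: trmx_inj; rewrite PsiE rmulf_tr linearZ /= map_trmx trmxK.
- by apply: trmx_inj; rewrite !rmulf_tr tr_scalar_mx -gPsi map_trmx trmx_inv trmxK.
exists xi; split=> //.
  have := wn_system_tr (T := transp T) bT' bT wn.
  by rewrite !traK trmxK.
have := wn_system_tr (T := transp T) bT' bT wnK.
rewrite !traK lmulf_tr trmxK tr_scalar_mx trmxK.
have -> // : tra (fun k => tra (A n.+1) k *m map_mx polyC K) =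
  (fun k => map_mx polyC K^T *m A n.+1 k).
by apply/funext => k; rewrite /tra trmx_mul trmxK map_trmx.
Qed.

End LeftCircuit.

Section Attached.
Variables (R : realType) (p q : nat).

Lemma invmxM n (X Y : 'M[R]_n) : X \in unitmx -> Y \in unitmx ->
  invmx (X *m Y) = invmx Y *m invmx X.
Proof.
move=> uX uY; have uXY : X *m Y \in unitmx by rewrite unitmx_mul uX.
by rewrite -[RHS](mulmxK uXY) mulmxA mulmxKV // mulVmx // mul1mx.
Qed.

Lemma attached_moment_gaugel T (xi H : 'M[R]_q) (nu : 'M[R]_p) n :
  xi \in unitmx -> H \in unitmx ->
  attached_moment T (xi *m H) nu n = invmx H *m attached_moment T xi nu n.
Proof. by move=> uxi uH; rewrite /attached_moment invmxM // !mulmxA. Qed.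

Lemma attached_moment_gauger T (xi : 'M[R]_q) (nu K : 'M[R]_p) n :
  nu \in unitmx -> K \in unitmx ->
  attached_moment T xi (nu *m K^T) n = attached_moment T xi nu n *m invmx K.
Proof.
move=> unu uK; rewrite /attached_moment invmxM ?unitmx_tr // trmx_mul -trmx_inv.
by rewrite trmxK !mulmxA.
Qed.

End Attached.

Section CyclicWord.
Variables (R : realType) (p q : nat) (L U : nat -> smx R).
Hypotheses (hL : forall a, (1 <= a <= p)%N -> pos_lower (L a))
  (hU : forall b, (1 <= b <= q)%N -> pos_upper (U b)).

Lemma cfactor_row_banded i : (1 <= i <= p + q)%N -> row_banded (cfactor p q L U i).
Proof.
move=> ipq; rewrite /cfactor; case: leqP => ip.
  have [[X0 _] _] : lower_inv (L i) /\ row_banded (transp (L i)).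
    by apply/pos_lower_inv/hL; lia.
  exact: lower_tri_row_banded.
have qi : (1 <= q - (i - p) + 1 <= q)%N by lia.
by have [] := pos_upper_inv (hU qi).
Qed.

Lemma Fprod_cat m k n : (1 <= m <= k)%N -> (k <= n <= (p + q).+1)%N ->
  Fprod p q L U m n = smul (Fprod p q L U m k) (Fprod p q L U k n).
Proof.
move=> mk kn; apply: smul_prod_cat => [|i ik]; first by lia.
by apply: cfactor_row_banded; lia.
Qed.

Lemma Fprod_lower : Fprod p q L U 1 p.+1 = Lprod p L.
Proof.
by apply: eq_big_nat => i /andP[_ ip]; rewrite /cfactor -ltnS ip.
Qed.

Lemma Fprod_upper : Fprod p q L U p.+1 (p + q).+1 = Uprod q U.
Proof.
rewrite /Fprod -[p.+1]add0n big_addn /Uprod.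
have -> : ((p + q).+1 - p.+1 = q)%N by lia.
apply: eq_big_nat => i /andP[_ iq]; rewrite /cfactor ifF; last by lia.
by congr U; lia.
Qed.

Lemma Fprod_nil m : Fprod p q L U m m = sid R.
Proof. by rewrite /Fprod big_geq. Qed.

(** In the cyclic word, position p + q - j + 1 holds U_j. *)
Lemma Fprod1 j : (1 <= j <= q)%N ->
  Fprod p q L U (p + q - j + 1)%N (p + q - j + 2)%N = U j.
Proof.
move=> jq; rewrite addn1 addn2 /Fprod smul_prod1 /cfactor ifF; last by lia.
by congr U; lia.
Qed.

Lemma Tcyc_start : Tcyc p q L U 1 = smul (Lprod p L) (Uprod q U).
Proof.
rewrite /Tcyc Fprod_nil smulm1 (@Fprod_cat 1 p.+1) ?Fprod_lower ?Fprod_upper //.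
by lia.
Qed.

Lemma Tcyc_end : Tcyc p q L U p.+1 = smul (Uprod q U) (Lprod p L).
Proof. by rewrite /Tcyc Fprod_lower Fprod_upper. Qed.

Lemma Tcyc_move j : (1 <= j <= q)%N ->
  let G := smul (Fprod p q L U (p + q - j + 2)%N (p + q).+1)
                (Fprod p q L U 1 (p + q - j + 1)%N) in
  Tcyc p q L U (cidx p q j.-1) = smul G (U j) /\
  Tcyc p q L U (cidx p q j) = smul (U j) G.
Proof.
move=> jq G.
have bF m n : (1 <= m)%N -> (n <= (p + q).+1)%N -> row_banded (Fprod p q L U m n).
  by move=> m1 npq; apply: row_banded_prod => i ik; apply: cfactor_row_banded; lia.
split; last first.
  have -> : cidx p q j = (p + q - j + 1)%N by case: j jq {G}.
  rewrite /Tcyc (@Fprod_cat _ (p + q - j + 2)%N); try lia.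
  by rewrite Fprod1 // smulA -?[U j]Fprod1 //; apply: bF; lia.
rewrite /G smulA; try (by apply: bF; lia).
rewrite -[in RHS](Fprod1 jq) -Fprod_cat; try lia.
(* The first move starts from position 1, the cyclic successor of p + q. *)
case: j jq {G} => // -[|j] jq; last first.
  by rewrite /Tcyc /= (_ : p + q - j.+2 + 2 = p + q - j.+1 + 1)%N //; lia.
rewrite /Tcyc /= Fprod_nil smulm1 (_ : p + q - 1 + 2 = (p + q).+1)%N; last by lia.
by rewrite Fprod_nil smul1m.
Qed.

End CyclicWord.

Lemma cidx_end p q : (0 < q)%N -> cidx p q q = p.+1.
Proof. by case: q => // q _; rewrite /cidx; lia. Qed.

Theorem corollary6p20 (R : realType) (p q : nat) (hp : (0 < p)%N) (hq : (0 < q)%N)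
  (L U : nat -> smx R)
  (hL : forall a, (1 <= a <= p)%N -> pos_lower (L a))
  (hU : forall b, (1 <= b <= q)%N -> pos_upper (U b))
  (T : smx R) (hT : T = smul (Lprod p L) (Uprod q U)) :
  (* the cyclic word: endpoints, and the single moves of the upper factors *)
  [/\ Tcyc p q L U (cidx p q 0) = T,
      Tcyc p q L U (cidx p q q) = Tcyc p q L U p.+1,
      Tcyc p q L U p.+1 = smul (Uprod q U) (Lprod p L)
    & forall j, (1 <= j <= q)%N ->
        let G := smul (Fprod p q L U (p + q - j + 2)%N (p + q).+1)
                      (Fprod p q L U 1 (p + q - j + 1)%N) in
        Tcyc p q L U (cidx p q j.-1) = smul G (U j) /\
        Tcyc p q L U (cidx p q j) = smul (U j) G] /\
  (* (i) and (ii) *)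
  (forall (xi : nat -> 'M[R]_q) (nu : 'M[R]_p)
      (B : nat -> rarray R q) (A : nat -> larray R p)
      (Psi : nat -> functional_mx R p q) (S : nat -> 'M[{poly R}]_q),
    wn_system hp hq (Tcyc p q L U (cidx p q 0)) (xi 0%N) nu
      (B 0%N) (A 0%N) (Psi 0%N) ->
    nonsing_lower (xi 0%N) -> nonsing_lower nu ->
    right_maximal (B 0%N) ->
    (forall j, (1 <= j <= q)%N ->
      [/\ nonsing_lower (xi j),
          right_array (Tcyc p q L U (cidx p q j)) (xi j) (B j)
        & right_maximal (B j)]) ->
    (forall j, (1 <= j <= q)%N ->
      forall n, mulTB (U j) (B j.-1) n = B j n *m S j) ->
    (forall j, (1 <= j <= q)%N -> A j = mulAT (A j.-1) (sinv (U j))) ->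
    (forall j, (1 <= j <= q)%N -> Psi j = lmulf (S j) (Psi j.-1)) ->
    exists H : 'M[R]_q,
      [/\ nonsing_lower H,
          \prod_(0 <= j < q) S (q - j)%N = 'X *: map_mx polyC H,
          Psi q = lmulf ('X *: map_mx polyC H) (Psi 0%N)
        & exists nuq : 'M[R]_p,
          [/\ nonsing_lower nuq,
              wn_system hp hq (Tcyc p q L U p.+1) (xi q) nuq (B q) (A q) (Psi q),
              represents (Tcyc p q L U p.+1) (xi q) nuq (Psi q)
            & [/\ forall n,
                    attached_moment (Tcyc p q L U p.+1) (xi q *m H) nuq n =
                    invmx H *m attached_moment (Tcyc p q L U p.+1) (xi q) nuq n,
                  lmulf (map_mx polyC (invmx H)) (Psi q) = lmulf 'X%:M (Psi 0%N),
                  wn_system hp hq (Tcyc p q L U p.+1) (xi q *m H) nuq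
                    (fun n => B q n *m map_mx polyC H) (A q)
                    (lmulf 'X%:M (Psi 0%N))
                & represents (Tcyc p q L U p.+1) (xi q *m H) nuq
                    (lmulf 'X%:M (Psi 0%N))]]]) /\
  (* (iii) *)
  (forall (xi : 'M[R]_q) (nu : nat -> 'M[R]_p)
      (B : nat -> rarray R q) (A : nat -> larray R p)
      (Psi : nat -> functional_mx R p q) (C : nat -> 'M[{poly R}]_p),
    wn_system hp hq (Tcyc p q L U 1) xi (nu 1%N) (B 1%N) (A 1%N) (Psi 1%N) ->
    left_maximal (A 1%N) ->
    (forall a, (1 <= a <= p)%N ->
      [/\ nonsing_lower (nu a.+1),
          left_array (Tcyc p q L U a.+1) (nu a.+1) (A a.+1)
        & left_maximal (A a.+1)]) ->
    (forall a, (1 <= a <= p)%N ->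
      forall n, mulAT (A a) (L a) n = C a *m A a.+1 n) ->
    (forall a, (1 <= a <= p)%N -> B a.+1 = mulTB (sinv (L a)) (B a)) ->
    (forall a, (1 <= a <= p)%N -> Psi a.+1 = rmulf (Psi a) (C a)) ->
    exists K : 'M[R]_p,
      [/\ nonsing_upper K,
          \prod_(1 <= a < p.+1) C a = 'X *: map_mx polyC K,
          Psi p.+1 = rmulf (Psi 1%N) ('X *: map_mx polyC K)
        & exists xip : 'M[R]_q,
          [/\ nonsing_lower xip,
              wn_system hp hq (Tcyc p q L U p.+1) xip (nu p.+1)
                (B p.+1) (A p.+1) (Psi p.+1),
              represents (Tcyc p q L U p.+1) xip (nu p.+1) (Psi p.+1)
            & [/\ forall n,
                    attached_moment (Tcyc p q L U p.+1) xip (nu p.+1 *m K^T) n =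
                    attached_moment (Tcyc p q L U p.+1) xip (nu p.+1) n *m invmx K,
                  rmulf (Psi p.+1) (map_mx polyC (invmx K)) = rmulf (Psi 1%N) 'X%:M,
                  wn_system hp hq (Tcyc p q L U p.+1) xip (nu p.+1 *m K^T)
                    (B p.+1) (fun n => map_mx polyC K *m A p.+1 n)
                    (rmulf (Psi 1%N) 'X%:M)
                & represents (Tcyc p q L U p.+1) xip (nu p.+1 *m K^T)
                    (rmulf (Psi 1%N) 'X%:M)]]]).
Proof.
have hL' a : (1 <= a <= p)%N -> lower_inv (L a) /\ row_banded (transp (L a)).
  by move=> ap; exact/pos_lower_inv/hL.
have hU' b : (1 <= b <= q)%N -> lower_inv (transp (U b)) /\ row_banded (U b).
  by move=> bq; exact/pos_upper_inv/hU.
have iLp : lower_inv (Lprod p L).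
  by apply: lower_inv_prod => i ik; case: (hL' i); first by lia.
have bLp' : row_banded (transp (Lprod p L)).
  by apply: row_banded_transp_prod => i ik; case: (hL' i); first by lia.
have iUp : lower_inv (transp (Uprod q U)).
  by apply: lower_inv_transp_prod => i ik; case: (hU' (q - i)%N); first by lia.
have bUp : row_banded (Uprod q U).
  by apply: row_banded_prod => i ik; case: (hU' (q - i)%N); first by lia.
have T1 := Tcyc_start hL hU; have Tp := Tcyc_end p q L U.
have bTp : row_banded (Tcyc p q L U p.+1).
  by rewrite Tp; apply: row_banded_smul => //; exact: lower_tri_row_banded iLp.1.
have cidxq := cidx_end p hq.
split; [|split].
- split; first by rewrite T1.
  + by rewrite cidxq.
  + exact: Tp.
  + by move=> j; exact: Tcyc_move.
- move=> xi nu B A Psi S wn0 _ _ _ hB WB WA SPsi.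
  rewrite /= T1 in wn0.
  have q1 : (1 <= q <= q)%N by rewrite hq leqnn.
  have [nxi rB [sB _]] := hB q q1; rewrite cidxq in rB.
  have [H [nH PE PsiE gPsi [nuq [nnu wn wnH]]]] :=
    right_circuit iLp bLp' hU' Tp wn0 nxi rB sB WB WA SPsi.
  have [_ uH] := nH; have [_ uxi] := nxi; have [_ unu] := nnu.
  exists H; split=> //; exists nuq; split=> //.
    exact: wn_system_represents wn.
  split=> // [n|]; first exact: attached_moment_gaugel.
  by apply: wn_system_represents wnH; rewrite // unitmx_mul uxi.
move=> xi nu B A Psi C wn0 _ hA VA VB CPsi.
rewrite T1 in wn0.
have p1 : (1 <= p <= p)%N by rewrite hp leqnn.
have [nnu lA [sA _]] := hA p p1.
have [K [nK PE PsiE gPsi [xip [nxi wn wnK]]]] :=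
  left_circuit iUp bUp hL' Tp wn0 nnu lA sA VA VB CPsi.
have [_ uK] := nK; have [_ uxi] := nxi; have [_ unu] := nnu.
exists K; split=> //; exists xip; split=> //.
  exact: wn_system_represents wn.
split=> // [n|]; first exact: attached_moment_gauger.
by apply: wn_system_represents wnK; rewrite // unitmx_mul unu unitmx_tr.
Qed.
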